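(* In the two-bus setting of the context, there exists $\eta>0$ such that for every $\mu\in\mathbb{R}^4$ with $\|\mu\|<\eta$ satisfying the standing assumptions on $\mu$, there exists $\epsilon=(\epsilon_1,\epsilon_2)$ with $\epsilon_1,\epsilon_2\ge0$ such that the set $\mathcal A_\epsilon^-=\{(\psi,x)\in\mathbb{R}^2:|\psi|\le k_1^-+\epsilon_1,\ |x|\le k_2^-+\epsilon_2\}$ is $F_\mu$-invariant (i.e. $F_\mu$ is well defined on it and $F_\mu(\mathcal A_\epsilon^-)\subseteq\mathcal A_\epsilon^-$) and $F_\mu$ is a contraction on $\mathcal A_\epsilon^-$ in the $\ell_\infty$ norm, i.e. there is $c\in[0,1)$ with $\|F_\mu(\xi)-F_\mu(\xi')\|_\infty\le c\|\xi-\xi'\|_\infty$ for all $\xi,\xi'\in\mathcal A_\epsilon^-$.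
   Context: Two-bus system. Fixed real data: series susceptance $b>0$, generator (slack) voltage $V_2>0$, load injections $\bar P_1,Q_1$. The perturbation vector is $\mu=(g,b_c,\bar t,\theta_{\mathrm s})\in\mathbb{R}^4$ (series conductance, shunt susceptance, transformer tap ratio minus one, transformer phase shift). Define $$\tilde g=\frac{g\cos\theta_{\mathrm s}-b\sin\theta_{\mathrm s}}{\bar t+1},\quad \tilde b=\frac{b\cos\theta_{\mathrm s}+g\sin\theta_{\mathrm s}}{\bar t+1},\quad \hat b=b-\frac{b_c}{2},\quad \rho=\frac{g}{\hat b},\quad \tilde\rho=\frac{\tilde g}{\tilde b},\quad k_\mu=\frac{b\hat b}{\tilde b^2}.$$ Standing assumptions on $\mu$: $\bar t>-1$, $\hat b>0$, $\tilde b>0$, $\rho\ge0$, $\tilde\rho\ge0$. Loading margins (independent of $\mu$): $\gamma_P=\bar P_1/(bV_2^2)$, $\gamma_Q=Q_1/(bV_2^2)$, with standing assumptions $\gamma_P<0$, $\gamma_Q\le0$ (active load, inductive), and $0<4\gamma_P^2-4\gamma_Q<1$. Constants: $k_2^-=1-\sqrt{\tfrac12+\gamma_Q+\sqrt{\tfrac14+\gamma_Q-\gamma_P^2}}$ and $k_1^-=-\gamma_P/(1-k_2^-)$. The map $F_\mu$: for $\xi=(\psi,x)$ with $|\psi|\le1$, $x>-1$, $F_\mu(\xi)=(\psi^+,x^+)$, where $$\psi^+=\frac{-k_\mu\gamma_P}{x+1}+\rho(x+1)-\tilde\rho\sqrt{1-\psi^2},\qquad x^+=\frac{k_\mu\gamma_Q}{x+1}-\tilde\rho\,\psi^++\sqrt{1-(\psi^+)^2}-1,$$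 defined when $|\psi^+|\le1$. *)

(* Defs.v *)
From HB Require Import structures.
From mathcomp Require Import all_boot all_order all_algebra.
From mathcomp Require Import all_classical all_reals all_analysis.
Set Implicit Arguments.
Unset Strict Implicit.
Unset Printing Implicit Defensive.
Import Order.TTheory GRing.Theory Num.Theory.
Import numFieldNormedType.Exports.
Local Open Scope classical_set_scope.
Local Open Scope ring_scope.

Section TwoBus.
Context {R : realType}.

(* The perturbation vector mu = (g, b_c, tbar, theta_s) is a row vector of
   R^4; its entries are numbered from 0. *)
Definition series_conductance (mu : 'rV[R]_4) : R := mu 0 0.
Definition shunt_susceptance (mu : 'rV[R]_4) : R := mu 0 1.
Definition tap_deviation (mu : 'rV[R]_4) : R := mu 0 2.
Definition phase_shift (mu : 'rV[R]_4) : R := mu 0 3.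

(* Euclidean norm; the library norm `|mu| on row vectors is the sup norm. *)
Definition norm2 (n : nat) (v : 'rV[R]_n) : R :=
  Num.sqrt (\sum_(i < n) v 0 i ^+ 2).

Definition gtilde (b : R) (mu : 'rV[R]_4) : R :=
  (series_conductance mu * cos (phase_shift mu) - b * sin (phase_shift mu))
    / (tap_deviation mu + 1).

Definition btilde (b : R) (mu : 'rV[R]_4) : R :=
  (b * cos (phase_shift mu) + series_conductance mu * sin (phase_shift mu))
    / (tap_deviation mu + 1).

Definition bhat (b : R) (mu : 'rV[R]_4) : R := b - shunt_susceptance mu / 2.

Definition rho (b : R) (mu : 'rV[R]_4) : R := series_conductance mu / bhat b mu.

Definition rhotilde (b : R) (mu : 'rV[R]_4) : R := gtilde b mu / btilde b mu.

Definition kmu (b : R) (mu : 'rV[R]_4) : R :=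
  b * bhat b mu / btilde b mu ^+ 2.

Definition admissible (b : R) (mu : 'rV[R]_4) : Prop :=
  [/\ -1 < tap_deviation mu, 0 < bhat b mu, 0 < btilde b mu,
      0 <= rho b mu & 0 <= rhotilde b mu].

Definition gammaP (b V2 P1 : R) : R := P1 / (b * V2 ^+ 2).
Definition gammaQ (b V2 Q1 : R) : R := Q1 / (b * V2 ^+ 2).

Definition k2minus (gP gQ : R) : R :=
  1 - Num.sqrt (1 / 2 + gQ + Num.sqrt (1 / 4 + gQ - gP ^+ 2)).

Definition k1minus (gP gQ : R) : R := - gP / (1 - k2minus gP gQ).

Definition psi_next (b gP : R) (mu : 'rV[R]_4) (xi : R * R) : R :=
  - kmu b mu * gP / (xi.2 + 1) + rho b mu * (xi.2 + 1)
    - rhotilde b mu * Num.sqrt (1 - xi.1 ^+ 2).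

Definition x_next (b gP gQ : R) (mu : 'rV[R]_4) (xi : R * R) : R :=
  kmu b mu * gQ / (xi.2 + 1) - rhotilde b mu * psi_next b gP mu xi
    + Num.sqrt (1 - psi_next b gP mu xi ^+ 2) - 1.

(* [F] is a total function whose values are meaningful only on [F_domain],
   since Num.sqrt vanishes on negative reals and x / 0 = 0. *)
Definition F (b gP gQ : R) (mu : 'rV[R]_4) (xi : R * R) : R * R :=
  (psi_next b gP mu xi, x_next b gP gQ mu xi).

Definition F_domain (b gP : R) (mu : 'rV[R]_4) : set (R * R) :=
  [set xi | [/\ `|xi.1| <= 1, -1 < xi.2 & `|psi_next b gP mu xi| <= 1]].

Definition Aminus (gP gQ : R) (eps : R * R) : set (R * R) :=
  [set xi | `|xi.1| <= k1minus gP gQ + eps.1 /\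
            `|xi.2| <= k2minus gP gQ + eps.2].

Definition F_invariant (b gP gQ : R) (mu : 'rV[R]_4) (A : set (R * R)) : Prop :=
  A `<=` F_domain b gP mu /\ F b gP gQ mu @` A `<=` A.

(* The library norm on R * R is the sup norm `|xi| = max `|xi.1| `|xi.2|. *)
Definition contracting_on (A : set (R * R)) (f : R * R -> R * R) : Prop :=
  exists c : R, 0 <= c < 1 /\
    forall xi xi' : R * R, A xi -> A xi' ->
      `|f xi - f xi'| <= c * `|xi - xi'|.

End TwoBus.

(* Main.v *)
(* Write p = -gP, q = -gQ. Unperturbed, F depends on y = x + 1 only:
   psi+ = p / y and y+ = -q / y + sqrt (1 - p^2 / y^2). Its fixed points have
   y^2 = t with t^2 - (1 - 2q) t + p^2 + q^2 = 0, and 1 - k2minus is the square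
   root of the larger root. For t strictly between the two roots, the lower
   bound sqrt t on y is mapped strictly above itself, and if moreover
   t^2 > p^2 + q^2, the product of the roots, the Lipschitz constant on the
   corresponding box is less than 1. The midpoint t = 1/2 - q satisfies both,
   so one box, enlarged slightly in psi, satisfies all the requirements with
   strict inequalities; these survive small perturbations, as kmu tends to 1 and
   rho, rhotilde tend to 0. Thus eps can be chosen independently of mu. *)
Require Import Defs.
From HB Require Import structures.
From mathcomp Require Import all_boot all_order all_algebra.
From mathcomp Require Import all_classical all_reals all_analysis.
From mathcomp Require Import ring lra.
Import Order.TTheory GRing.Theory Num.Theory.
Import numFieldNormedType.Exports.
Local Open Scope classical_set_scope.
Local Open Scope ring_scope.

(** * Elementary estimates for the square root and the reciprocal *)

Lemma sqrt_1Bsqr_ge (R : realType) (K u : R) :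
  `|u| <= K -> Num.sqrt (1 - K ^+ 2) <= Num.sqrt (1 - u ^+ 2).
Proof.
move=> uK; rewrite ler_wsqrtr// lerD2l lerN2 -(real_normK (num_real u)).
by rewrite lerXn2r ?nnegrE// (le_trans _ uK).
Qed.

(** With [A], [B] the two roots, [(A - B) * (A + B) = v^2 - u^2]. Each root is at least
    [sqrt (1 - K^2)] and [|u + v| <= 2K], so dividing by [A + B] gives the constant. *)
Lemma sqrt_1Bsqr_lipschitz (R : realType) (K u v : R) :
  K < 1 -> `|u| <= K -> `|v| <= K ->
  `|Num.sqrt (1 - u ^+ 2) - Num.sqrt (1 - v ^+ 2)|
    <= K / Num.sqrt (1 - K ^+ 2) * `|u - v|.
Proof.
move=> K1 uK vK; have K0 : 0 <= K by exact: le_trans uK.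
have W0 : 0 < Num.sqrt (1 - K ^+ 2) by rewrite sqrtr_gt0; nra.
have nonneg w : `|w| <= K -> 0 <= 1 - w ^+ 2.
  by rewrite ler_norml => /andP[? ?]; nra.
have uW := sqrt_1Bsqr_ge _ _ _ uK; have vW := sqrt_1Bsqr_ge _ _ _ vK.
have uE := sqr_sqrtr (nonneg _ uK); have vE := sqr_sqrtr (nonneg _ vK).
set W := Num.sqrt _ in W0 uW vW *.
set A := Num.sqrt _ in uW uE *; set B := Num.sqrt _ in vW vE *.
have AB : `|A - B| * (A + B) = `|u - v| * `|u + v|.
  rewrite -[A + B]ger0_norm; last lra.
  by rewrite -!normrM -[RHS]normrN; congr (`| _ |); nra.
have uv : `|u + v| <= K + K by rewrite (le_trans (ler_normD _ _))// lerD.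
rewrite mulrAC ler_pdivlMr//.
have := normr_ge0 (A - B); have := normr_ge0 (u - v); nra.
Qed.

Lemma div_lipschitz (R : realType) (c y u v : R) :
  0 < y -> y <= u -> y <= v ->
  `|c / u - c / v| <= `|c| / y ^+ 2 * `|u - v|.
Proof.
move=> y0 yu yv.
have u0 : 0 < u by exact: lt_le_trans yu.
have v0 : 0 < v by exact: lt_le_trans yv.
have -> : c / u - c / v = c * (v - u) / (u * v).
  by field; rewrite !gt_eqF.
rewrite !normrM normfV distrC (gtr0_norm (mulr_gt0 u0 v0)) mulrAC.
rewrite ler_wpM2r// ler_wpM2l// lef_pV2 ?posrE ?mulr_gt0 ?exprn_gt0//.
by rewrite expr2 ler_pM// ltW.
Qed.

(** * Invariance and contraction of a box under explicit inequalities *)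

(** The first two terms of [psi_next] are nonnegative and the third is nonpositive, so [K] only has
    to dominate each group separately; [y <= x + 1 <= 2] bounds the first group. *)
Lemma psi_next_bounds (R : realType) (b gP y K : R) (mu : 'rV[R]_4) (xi : R * R) :
  gP < 0 -> 0 < y -> 0 <= kmu b mu -> 0 <= rho b mu -> 0 <= rhotilde b mu ->
  kmu b mu * - gP / y + rho b mu * 2 <= K -> rhotilde b mu <= K ->
  `|xi.2| <= 1 - y -> `|psi_next b gP mu xi| <= K.
Proof.
rewrite /psi_next => gP0 y0 k0 r0 rt0 HK rtK.
rewrite !ler_norml => /andP[x1 x2].
set k := kmu b mu in k0 HK *; set r := rho b mu in r0 HK *.
set rt := rhotilde b mu in rt0 rtK *.
have S0 := sqrtr_ge0 (1 - xi.1 ^+ 2).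
have S1 : Num.sqrt (1 - xi.1 ^+ 2) <= 1.
  by rewrite -[leRHS]sqrtr1 ler_wsqrtr//; nra.
set S := Num.sqrt _ in S0 S1 *.
have kg : 0 <= k * - gP by nra.
have frac : 0 <= k * - gP / (xi.2 + 1) <= k * - gP / y.
  rewrite divr_ge0//=; last lra.
  by rewrite ler_wpM2l// lef_pV2 ?posrE; lra.
move: frac => /andP[f1 f2].
have -> : - k * gP = k * - gP by ring.
by apply/andP; split; nra.
Qed.

(** The box is described by its half-widths [K] and [1 - y], so that [y] is the least value of
    [x + 1] on it. [c1] and [c2] are Lipschitz constants of the two components; [c1] enters [c2]
    because [x_next] is computed from [psi_next]. *)
Lemma box_invariant_contracting (R : realType) (b gP gQ y K : R)
    (mu : 'rV[R]_4) (eps : R * R) :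
  gP < 0 -> gQ <= 0 -> 0 < y -> K < 1 ->
  k1minus gP gQ + eps.1 = K -> k2minus gP gQ + eps.2 = 1 - y ->
  0 <= kmu b mu -> 0 <= rho b mu -> 0 <= rhotilde b mu ->
  rhotilde b mu <= K -> rhotilde b mu <= 1 - y ->
  kmu b mu * - gP / y + rho b mu * 2 <= K ->
  kmu b mu * - gQ / y + rhotilde b mu + y <= Num.sqrt (1 - K ^+ 2) ->
  let W := Num.sqrt (1 - K ^+ 2) in
  let c1 := kmu b mu * - gP / y ^+ 2 + rho b mu + rhotilde b mu * (K / W) in
  let c2 := kmu b mu * - gQ / y ^+ 2 + (rhotilde b mu + K / W) * c1 in
  c1 < 1 -> c2 < 1 ->
  F_invariant b gP gQ mu (Aminus gP gQ eps) /\
  contracting_on (Aminus gP gQ eps) (F b gP gQ mu).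
Proof.
move=> gP0 gQ0 y0 K1 e1 e2 k0 r0 rt0 rtK rty HK HW W c1 c2 c1lt c2lt.
have psiK xi : `|xi.2| <= 1 - y -> `|psi_next b gP mu xi| <= K.
  exact: psi_next_bounds.
have K0 : 0 <= K by exact: le_trans rtK.
have kq : 0 <= kmu b mu * - gQ by nra.
have kp : 0 <= kmu b mu * - gP by nra.
split.
  split.
    move=> xi [/=]; rewrite e1 e2 => p1 p2; split.
    - by rewrite (le_trans p1)// ltW.
    - by move: p2; rewrite ler_norml => /andP[? ?]; lra.
    - by rewrite (le_trans (psiK _ p2))// ltW.
  move=> _ [xi [/=+ + <-]]; rewrite e1 e2 => p1 p2.
  rewrite /Aminus /= e1 e2; split; first exact: psiK.
  have pK := psiK _ p2; have SW := sqrt_1Bsqr_ge _ _ _ pK.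
  rewrite /x_next; set ps := psi_next _ _ _ _ in pK SW *.
  have S1 : Num.sqrt (1 - ps ^+ 2) <= 1.
    by rewrite -[leRHS]sqrtr1 ler_wsqrtr//; nra.
  set S := Num.sqrt (1 - ps ^+ 2) in S1 SW *.
  move: p2 pK; rewrite !ler_norml => /andP[x1 x2] /andP[ps1 ps2].
  have frac : 0 <= kmu b mu * - gQ / (xi.2 + 1) <= kmu b mu * - gQ / y.
    rewrite divr_ge0//=; last lra.
    by rewrite ler_wpM2l// lef_pV2 ?posrE; lra.
  move: frac => /andP[f1 f2].
  have -> : kmu b mu * gQ / (xi.2 + 1) = - (kmu b mu * - gQ / (xi.2 + 1)) by ring.
  (* Since [|ps| <= K < 1], the term in [rhotilde] is at most [rhotilde] in absolute value. The
     lower bound then comes from [HW], the upper one from [S <= 1] and [rty]. *)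
  by apply/andP; split; nra.
have W0 : 0 < W by rewrite sqrtr_gt0; nra.
have KW0 : 0 <= K / W by rewrite divr_ge0// ltW.
have kp2 : 0 <= kmu b mu * - gP / y ^+ 2 by rewrite divr_ge0// exprn_ge0// ltW.
have kq2 : 0 <= kmu b mu * - gQ / y ^+ 2 by rewrite divr_ge0// exprn_ge0// ltW.
have c10 : 0 <= c1 by rewrite /c1 !addr_ge0// mulr_ge0.
have c20 : 0 <= c2 by rewrite /c2 addr_ge0// mulr_ge0// addr_ge0.
exists (Num.max c1 c2); split; first by rewrite le_max c10/= gt_max c1lt.
move=> xi xi'; rewrite /Aminus/= e1 e2 => -[a1 a2] [a1' a2'].
set d := `|xi - xi'|.
have d1 : `|xi.1 - xi'.1| <= d by rewrite /d prod_normE/= le_max lexx.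
have d2 : `|xi.2 - xi'.2| <= d by rewrite /d prod_normE/= le_max lexx orbT.
have y1 : y <= xi.2 + 1 by move: a2; rewrite ler_norml => /andP[? ?]; lra.
have y1' : y <= xi'.2 + 1 by move: a2'; rewrite ler_norml => /andP[? ?]; lra.
have yd : (xi.2 + 1) - (xi'.2 + 1) = xi.2 - xi'.2 by ring.
have divd c : `|c / (xi.2 + 1) - c / (xi'.2 + 1)| <= `|c| / y ^+ 2 * d.
  apply: (le_trans (div_lipschitz _ _ _ _ _ y0 y1 y1')).
  by rewrite yd ler_wpM2l// divr_ge0// exprn_ge0// ltW.
have sq u v e : `|u| <= K -> `|v| <= K -> `|u - v| <= e ->
    `|Num.sqrt (1 - u ^+ 2) - Num.sqrt (1 - v ^+ 2)| <= K / W * e.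
  move=> uK vK uve; apply: (le_trans (sqrt_1Bsqr_lipschitz _ _ _ _ K1 uK vK)).
  exact: ler_wpM2l.
have psid : `|psi_next b gP mu xi - psi_next b gP mu xi'| <= c1 * d.
  have := sq _ _ _ a1 a1' d1; have := divd (kmu b mu * - gP).
  rewrite /psi_next /c1 (ger0_norm kp).
  set S := Num.sqrt (1 - xi.1 ^+ 2); set S' := Num.sqrt (1 - xi'.1 ^+ 2).
  move=> D1 D2.
  rewrite (_ : _ - _ =
    (kmu b mu * - gP / (xi.2 + 1) - kmu b mu * - gP / (xi'.2 + 1))
    + rho b mu * (xi.2 - xi'.2) - rhotilde b mu * (S - S')); last by ring.
  apply: (le_trans (ler_normB _ _)); rewrite mulrDl.
  apply: lerD; last by rewrite normrM ger0_norm// -mulrA ler_wpM2l.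
  apply: (le_trans (ler_normD _ _)); rewrite mulrDl lerD//.
  by rewrite normrM ger0_norm// ler_wpM2l.
have xd : `|x_next b gP gQ mu xi - x_next b gP gQ mu xi'| <= c2 * d.
  have := sq _ _ _ (psiK _ a2) (psiK _ a2') psid; have := divd (kmu b mu * gQ).
  rewrite -(normrN (_ * gQ)) -[- (_ * gQ)]mulrN (ger0_norm kq).
  move: psid; rewrite /x_next.
  set ps := psi_next _ _ _ xi; set ps' := psi_next _ _ _ xi'.
  set S := Num.sqrt (1 - ps ^+ 2); set S' := Num.sqrt (1 - ps' ^+ 2).
  move=> D0 D1 D2.
  rewrite (_ : _ - _ =
    (kmu b mu * gQ / (xi.2 + 1) - kmu b mu * gQ / (xi'.2 + 1))
    + (S - S') - rhotilde b mu * (ps - ps')); last by ring.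
  rewrite (_ : c2 * d = kmu b mu * - gQ / y ^+ 2 * d + K / W * (c1 * d)
    + rhotilde b mu * (c1 * d)); last by rewrite /c2; ring.
  apply: (le_trans (ler_normB _ _)); apply: lerD; last first.
    by rewrite normrM ger0_norm// ler_wpM2l.
  exact: (le_trans (ler_normD _ _) (lerD _ _)).
have d0 : 0 <= d by exact: normr_ge0.
rewrite prod_normE/= ge_max; apply/andP; split.
  by rewrite (le_trans psid)// ler_wpM2r// le_max lexx.
by rewrite (le_trans xd)// ler_wpM2r// le_max lexx orbT.
Qed.

(** * A box for the unperturbed map *)

(* [1 / 2 - q] is the midpoint of the two roots of
   [t^2 - (1 - 2q) t + p^2 + q^2]; it makes [q + y^2 = 1 / 2], and all
   conditions reduce to [p^2 < (y * K)^2 < 1 / 4 - q]. *)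
Lemma stable_box_exists (R : realType) (p q : R) :
  0 < p -> 0 <= q -> p ^+ 2 < 1 / 4 - q ->
  exists y K : R, let W := Num.sqrt (1 - K ^+ 2) in
    [/\ 0 < y, y ^+ 2 = 1 / 2 - q, p / y < K & K < 1] /\
    [/\ q / y + y < W, p / y ^+ 2 < 1 & q / y ^+ 2 + K / W * (p / y ^+ 2) < 1].
Proof.
move=> p0 q0 pa; set a := 1 / 4 - q in pa.
have a0 : 0 < a by nra.
have s0 := sqrtr_gt0 a; rewrite a0 in s0.
have sE := sqr_sqrtr (ltW a0).
set s := Num.sqrt a in s0 sE.
have ps : p < s by nra.
(* [z] is the future [y * K]; any value strictly between [p] and [sqrt a] would do. *)
pose z := (p + s) / 2.
have pz : p < z by rewrite /z; lra.
have zs : z < s by rewrite /z; lra.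
have za : z ^+ 2 < a by rewrite -sE; nra.
have t0 : 0 < 1 / 2 - q by rewrite /a in a0; lra.
pose y := Num.sqrt (1 / 2 - q).
have y0 : 0 < y by rewrite sqrtr_gt0.
have yE : y ^+ 2 = 1 / 2 - q by rewrite sqr_sqrtr// ltW.
have yN : y != 0 by rewrite gt_eqF.
have at4 : a = y ^+ 2 - 1 / 4 by rewrite yE /a; lra.
have q_y : q = 1 / 2 - y ^+ 2 by rewrite yE; ring.
exists y, (z / y) => W.
have K1 : z / y < 1 by rewrite ltr_pdivrMr// mul1r; nra.
have K0 : 0 < z / y by rewrite divr_gt0//; lra.
have KE : (z / y) ^+ 2 = z ^+ 2 / y ^+ 2 by rewrite expr_div_n.
have W2 : W ^+ 2 = 1 - (z / y) ^+ 2 by rewrite sqr_sqrtr//; nra.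
have W0 : 0 < W by rewrite sqrtr_gt0; nra.
have yW2 : (y * W) ^+ 2 = y ^+ 2 - z ^+ 2.
  by rewrite exprMn W2 KE; field.
(* [(y * W)^2 = y^2 - z^2 > y^2 - a = 1 / 4]. *)
have yW : 1 / 2 < y * W.
  have := mulr_gt0 y0 W0; nra.
split; first by split => //; rewrite ltr_pM2r// invr_gt0.
have y2 : 0 < y ^+ 2 by rewrite exprn_gt0.
split.
- rewrite q_y (_ : _ + _ = (1 / 2) / y); last by field.
  by rewrite ltr_pdivrMr// (mulrC W).
(* [p < s <= s^2 + 1 / 4 = y^2]. *)
- by rewrite ltr_pdivrMr// mul1r; nra.
- rewrite (_ : _ + _ = (q + (z * p) / (y * W)) / y ^+ 2); last first.
    by field; rewrite yN gt_eqF.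
  (* Here [y^2 - q = 2a], and [z * p < z^2 < a < 2a * (y * W)] by [yW]. *)
  rewrite ltr_pdivrMr// mul1r -ltrBrDl ltr_pdivrMr; last exact: mulr_gt0.
  by nra.
Qed.

(** * Limits of the parameters as the perturbation vanishes *)

Lemma coord_norm2_le (R : realType) (n : nat) (v : 'rV[R]_n) i :
  `|v 0 i| <= norm2 v.
Proof.
rewrite -sqrtr_sqr ler_wsqrtr// (bigD1 i)//= lerDl sumr_ge0// => j _.
exact: sqr_ge0.
Qed.

(** Neighbourhoods of 0 are given by sup-norm balls; this puts the Euclidean ball of the same radius
    inside. *)
Lemma mx_norm_le_norm2 (R : realType) (n : nat) (v : 'rV[R]_n) : `|v| <= norm2 v.
Proof.
rewrite /Num.norm/= mx_normrE; apply/bigmax_leP; split; first exact: sqrtr_ge0.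
by move=> [i j] _ /=; rewrite ord1 coord_norm2_le.
Qed.

Lemma cvg_coord0 (R : realType) (n : nat) i :
  (v : 'rV[R]_n) 0 i @[v --> (0 : 'rV[R]_n)] --> (0 : R).
Proof.
by have := @coord_continuous R 1 n 0 i 0; rewrite /continuous_at mxE; apply.
Qed.

Section SmallPerturbation.
Context (R : realType) (b : R) (U : set_system 'rV[R]_4) {FU : Filter U}.
Hypotheses (b0 : 0 < b) (U0 : forall i, (mu : 'rV[R]_4) 0 i @[mu --> U] --> (0 : R)).

Lemma cvg_cos_phase0 : cos (phase_shift mu) @[mu --> U] --> (1 : R).
Proof.
rewrite -cos0; apply: cvg_comp (U0 3) _.
exact: (@continuous_cos R 0).
Qed.

Lemma cvg_sin_phase0 : sin (phase_shift mu) @[mu --> U] --> (0 : R).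
Proof.
rewrite -[X in _ --> X]sin0; apply: cvg_comp (U0 3) _.
exact: (@continuous_sin R 0).
Qed.

Lemma cvg_inv_tap0 : (tap_deviation mu + 1)^-1 @[mu --> U] --> (1 : R).
Proof.
rewrite [X in _ --> X](_ : _ = (0 + 1)^-1); last by rewrite add0r invr1.
apply: cvgV; first by rewrite add0r oner_neq0.
by apply: cvgD; [exact: U0|exact: cvg_cst].
Qed.

Lemma cvg_gtilde0 : gtilde b mu @[mu --> U] --> (0 : R).
Proof.
rewrite (_ : 0 = (0 * 1 - b * 0) * 1); last by ring.
apply: cvgM cvg_inv_tap0; apply: cvgB.
  exact: cvgM (U0 _) cvg_cos_phase0.
exact: cvgM (cvg_cst _) cvg_sin_phase0.
Qed.

Lemma cvg_btilde0 : btilde b mu @[mu --> U] --> b.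
Proof.
rewrite [X in _ --> X](_ : _ = (b * 1 + 0 * 0) * 1); last by ring.
apply: cvgM cvg_inv_tap0; apply: cvgD.
  exact: cvgM (cvg_cst _) cvg_cos_phase0.
exact: cvgM (U0 _) cvg_sin_phase0.
Qed.

Lemma cvg_bhat0 : bhat b mu @[mu --> U] --> b.
Proof.
rewrite [X in _ --> X](_ : _ = b - 0 / 2); last by rewrite mul0r subr0.
apply: cvgB; first exact: cvg_cst.
exact: cvgM (U0 _) (cvg_cst _).
Qed.

Lemma cvg_rho0 : rho b mu @[mu --> U] --> (0 : R).
Proof.
rewrite -(mul0r b^-1); apply: cvgM; first exact: U0.
by apply: cvgV; [rewrite gt_eqF|exact: cvg_bhat0].
Qed.

Lemma cvg_rhotilde0 : rhotilde b mu @[mu --> U] --> (0 : R).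
Proof.
rewrite -(mul0r b^-1); apply: cvgM; first exact: cvg_gtilde0.
by apply: cvgV; [rewrite gt_eqF|exact: cvg_btilde0].
Qed.

Lemma cvg_kmu0 : kmu b mu @[mu --> U] --> (1 : R).
Proof.
have bN : b != 0 by rewrite gt_eqF.
rewrite [X in _ --> X](_ : _ = b * b / (b * b)); last by rewrite divff ?mulf_neq0.
apply: cvgM; first exact: cvgM (cvg_cst _) cvg_bhat0.
apply: cvgV; first exact: mulf_neq0.
exact: cvgM cvg_btilde0 cvg_btilde0.
Qed.

(** The hypotheses are the desired inequalities at the limit values [kmu = 1], [rho = rhotilde = 0].
    Being strict, they persist along [U]. *)
Lemma near_stable_box (p q y K W : R) :
  0 < K -> y < 1 -> p / y < K -> q / y + y < W ->
  p / y ^+ 2 < 1 -> q / y ^+ 2 + K / W * (p / y ^+ 2) < 1 ->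
  \forall mu \near U,
    let c1 := kmu b mu * p / y ^+ 2 + rho b mu + rhotilde b mu * (K / W) in
    [/\ rhotilde b mu <= K, rhotilde b mu <= 1 - y,
      kmu b mu * p / y + rho b mu * 2 <= K &
      kmu b mu * q / y + rhotilde b mu + y <= W] /\
    (c1 < 1 /\ kmu b mu * q / y ^+ 2 + (rhotilde b mu + K / W) * c1 < 1).
Proof.
move=> K0 y1 h1 h2 h3 h4.
have ck := cvg_kmu0; have cr := cvg_rho0.
have crt := cvg_rhotilde0.
have ckc (c d : R) : kmu b mu * c / d @[mu --> U] --> c / d.
  rewrite [X in _ --> X](_ : _ = 1 * c / d); last by rewrite mul1r.
  apply: cvgM; last exact: cvg_cst.
  by apply: cvgM => //; exact: cvg_cst.
have cr1 : (kmu b mu * p / y ^+ 2 + rho b mu + rhotilde b mu * (K / W))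
    @[mu --> U] --> p / y ^+ 2.
  rewrite [X in _ --> X](_ : _ = p / y ^+ 2 + 0 + 0 * (K / W)); last by ring.
  apply: cvgD; first exact: cvgD.
  by apply: cvgM => //; exact: cvg_cst.
have l1 : \forall mu \near U, rhotilde b mu < K by exact: cvgr_lt crt _ K0.
have l2 : \forall mu \near U, rhotilde b mu < 1 - y.
  by apply: cvgr_lt crt _ _; rewrite subr_gt0.
have l3 : \forall mu \near U, kmu b mu * p / y + rho b mu * 2 < K.
  apply: cvgr_lt h1.
  rewrite [X in _ --> X](_ : _ = p / y + 0 * 2); last by ring.
  by apply: cvgD => //; apply: cvgM => //; exact: cvg_cst.
have l4 : \forall mu \near U, kmu b mu * q / y + rhotilde b mu + y < W.
  apply: cvgr_lt h2.
  rewrite [X in _ --> X](_ : _ = q / y + 0 + y); last by ring.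
  by apply: cvgD; [exact: cvgD|exact: cvg_cst].
have l5 : \forall mu \near U,
    kmu b mu * p / y ^+ 2 + rho b mu + rhotilde b mu * (K / W) < 1.
  exact: cvgr_lt h3.
have l6 : \forall mu \near U, kmu b mu * q / y ^+ 2 + (rhotilde b mu + K / W) *
    (kmu b mu * p / y ^+ 2 + rho b mu + rhotilde b mu * (K / W)) < 1.
  apply: cvgr_lt h4.
  rewrite [X in _ --> X](_ : _ = q / y ^+ 2 + (0 + K / W) * (p / y ^+ 2)).
    apply: cvgD => //; apply: cvgM => //.
    by apply: cvgD => //; exact: cvg_cst.
  by rewrite add0r.
near=> mu; split; [split; apply: ltW|split]; near: mu; assumption.
Unshelve. all: by end_near. Qed.

End SmallPerturbation.

(** * Choice of [eta] and [eps] *)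

Theorem proposition3 (R : realType) (b V2 P1 Q1 : R) :
  0 < b -> 0 < V2 ->
  let gP := gammaP b V2 P1 in
  let gQ := gammaQ b V2 Q1 in
  gP < 0 -> gQ <= 0 ->
  0 < 4 * gP ^+ 2 - 4 * gQ < 1 ->
  exists eta : R, 0 < eta /\
    forall mu : 'rV[R]_4, norm2 mu < eta -> admissible b mu ->
      exists eps : R * R, 0 <= eps.1 /\ 0 <= eps.2 /\
        F_invariant b gP gQ mu (Aminus gP gQ eps) /\
        contracting_on (Aminus gP gQ eps) (F b gP gQ mu).
Proof.
move=> b0 _ gP gQ gP0 gQ0 /andP[_ lt1].
have p0 : 0 < - gP by rewrite oppr_gt0.
have q0 : 0 <= - gQ by rewrite oppr_ge0.
have pa : (- gP) ^+ 2 < 1 / 4 - - gQ by rewrite sqrrN; lra.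
have [y [K [[y0 yE pK K1] [HW h3 h4]]]] := stable_box_exists _ _ _ p0 q0 pa.
have K0 : 0 < K by exact: lt_trans (divr_gt0 p0 y0) pK.
(* [y^2 = 1 / 2 + gQ <= 1 / 2]. *)
have y1 : y < 1 by nra.
have near0 := near_stable_box _ _ _ b0 (cvg_coord0 R 4) _ _ _ _ _ K0 y1 pK HW h3 h4.
have [eta /= eta0 Heta] := (@nbhs_norm0P R 'rV[R]_4 _).1 (near0 _).
exists eta; split => // mu mu_eta [_ bh _ r0 rt0].
have [[rtK rty HK HxW] [c1 c2]] :=
  Heta mu (le_lt_trans (mx_norm_le_norm2 _ _ mu) mu_eta).
have k0 : 0 <= kmu b mu.
  by apply: divr_ge0; [exact: mulr_ge0 (ltW b0) (ltW bh)|exact: sqr_ge0].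
(* This [eps] makes the half-widths exactly [K] and [1 - y]. Its nonnegativity rests on [y <= V],
   where [V = 1 - k2minus]: the second entry is [V - y], and
   [k1minus = - gP / V <= - gP / y < K]. *)
exists (K - k1minus gP gQ, 1 - y - k2minus gP gQ) => /=.
pose V := Num.sqrt (1 / 2 + gQ + Num.sqrt (1 / 4 + gQ - gP ^+ 2)).
have yV : y <= V.
  have -> : y = Num.sqrt (y ^+ 2) by rewrite sqrtr_sqr gtr0_norm.
  by rewrite ler_wsqrtr// yE opprK lerDl sqrtr_ge0.
have k1K : k1minus gP gQ <= K.
  rewrite /k1minus /k2minus -/V opprB addrCA subrr addr0.
  by rewrite (le_trans _ (ltW pK))// ler_wpM2l ?lef_pV2 ?posrE ?(lt_le_trans y0)// ltW.
split; first by rewrite subr_ge0.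
split; first by rewrite /k2minus -/V; lra.
by apply: (box_invariant_contracting _ _ _ _ y K) => //=; ring.
Qed.
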